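(* Let $B=\bigcup_{i\ge 0}B_i$ be a filtered algebra over a field $K$ of characteristic zero such that the associated graded algebra $\operatorname{gr} B=\bigoplus_{i\ge 0}B_i/B_{i-1}$ is a commutative domain, and let $a\in B$. Then, for an arbitrary polynomial $f(t)\in K[t]$ of degree $>1$, $0$ is the only eigenvalue of the inner derivation $\operatorname{ad} f(a)$ of the algebra $B$; that is, if $\delta:=\operatorname{ad} f(a)\neq 0$ and $\delta(b)=\lambda b$ for some $\lambda\in K$ and $0\ne b\in B$, then $\lambda=0$.
   Context: Algebras are associative and unital. A filtered $K$-algebra $B=\bigcup_{i\ge0}B_i$ means: $B_0\subseteq B_1\subseteq\cdots$ are $K$-subspaces with $1\in B_0$, $B_iB_j\subseteq B_{i+j}$ for all $i,j\ge 0$, and $B_{-1}:=0$. For $u\in B$, $\operatorname{ad} u$ is the inner derivation $b\mapsto [u,b]=ub-bu$ of $B$. *)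

(* Defs.v *)
From HB Require Import structures.
From mathcomp Require Import all_boot all_order all_algebra.
From mathcomp Require Import boolp.

Set Implicit Arguments.
Unset Strict Implicit.
Unset Printing Implicit Defensive.

Import GRing.Theory.

Local Open Scope ring_scope.
Local Open Scope quotient_scope.

(* Subspaces are boolean predicates. Under the classical axioms of boolp this
   is no restriction: any P : B -> Prop is given by fun x => `[< P x >]. *)
Record filtration (K : fieldType) (B : algType K) := Filtration {
  filt :> nat -> {pred B};
  filt_submod : forall i, submod_closed (filt i);
  filt_subS : forall i, {subset filt i <= filt i.+1};
  filt1 : 1 \in filt 0;
  filtM : forall i j x y, x \in filt i -> y \in filt j -> x * y \in filt (i + j)%N;
  filt_exhaustive : forall x, exists i, x \in filt i
}.

Section AssociatedGraded.
Variables (K : fieldType) (B : algType K) (F : filtration B).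

(* B_{i-1}, with B_{-1} = 0. *)
Definition filt_prev (i : nat) : {pred B} :=
  if i is j.+1 then F j else pred1 0.

Lemma filt_zmod i : zmod_closed (F i).
Proof. exact: (GRing.submod_closedB (filt_submod F i)). Qed.

HB.instance Definition _ i := GRing.isZmodClosed.Build B (F i) (filt_zmod i).

Lemma filt_prev_zmod i : zmod_closed (filt_prev i).
Proof.
case: i => [|i] /=; last exact: filt_zmod.
by split=> [|x y /eqP-> /eqP->]; rewrite ?subr0 inE.
Qed.

HB.instance Definition _ i :=
  GRing.isZmodClosed.Build B (filt_prev i) (filt_prev_zmod i).

Lemma filt_le i j : (i <= j)%N -> {subset F i <= F j}.
Proof.
move=> /subnK <-; elim: (j - i)%N => [|k IHk] x Fx //.
by rewrite addSn; apply/filt_subS/IHk.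
Qed.

Lemma filt_prev_sub i : {subset filt_prev i <= F i}.
Proof.
by case: i => [|i] x /=; [move=> /eqP->; apply: rpred0 | apply: filt_subS].
Qed.

Lemma filt_prevMl i j x y :
  x \in filt_prev i -> y \in F j -> x * y \in filt_prev (i + j)%N.
Proof.
by case: i => [|i] /= Fx Fy; [rewrite (eqP Fx) mul0r rpred0 | apply: filtM].
Qed.

Lemma filt_prevMr i j x y :
  x \in F i -> y \in filt_prev j -> x * y \in filt_prev (i + j)%N.
Proof.
case: j => [|j] /= Fx Fy; first by rewrite (eqP Fy) mulr0 rpred0.
by rewrite addnS; apply: filtM.
Qed.

Definition filt_sub (i : nat) := {x : B | x \in F i}.

HB.instance Definition _ i := SubChoice.on (filt_sub i).
HB.instance Definition _ i :=
  GRing.SubChoice_isSubZmodule.Build B (F i) (filt_sub i) (filt_zmod i).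

Definition filt_sub_prev (i : nat) : {pred filt_sub i} :=
  [pred x | val x \in filt_prev i].

Lemma filt_sub_prev_zmod i : zmod_closed (@filt_sub_prev i).
Proof.
split=> [|x y]; first by rewrite inE raddf0 rpred0.
by rewrite !inE raddfB; apply: rpredB.
Qed.

HB.instance Definition _ i :=
  GRing.isZmodClosed.Build (filt_sub i) (@filt_sub_prev i)
    (@filt_sub_prev_zmod i).

(* The homogeneous component B_i / B_{i-1}. *)
Definition gr_comp (i : nat) := Quotient.quot (@filt_sub_prev i).

HB.instance Definition _ i := GRing.Zmodule.on (gr_comp i).

(* The class x + B_{i-1}; meaningful only for x in B_i. *)
Definition gr_cls (i : nat) (x : B) : gr_comp i :=
  \pi_(gr_comp i) (insubd (0 : filt_sub i) x).

Definition gr_rep (i : nat) (u : gr_comp i) : B := val (repr u).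

Lemma gr_rep_in i (u : gr_comp i) : gr_rep u \in F i.
Proof. exact: valP. Qed.

Lemma gr_repK i (u : gr_comp i) : gr_cls i (gr_rep u) = u.
Proof. by rewrite /gr_cls /gr_rep valKd reprK. Qed.

Lemma gr_clsB i x y : x \in F i -> y \in F i ->
  gr_cls i (x - y) = gr_cls i x - gr_cls i y.
Proof.
move=> Fx Fy; rewrite /gr_cls -raddfB; congr (\pi _).
by apply: val_inj; rewrite raddfB /= !insubdK //; apply: rpredB.
Qed.

Lemma gr_cls0 i : gr_cls i 0 = 0.
Proof. by rewrite -[0 in LHS](subrr 0) gr_clsB ?rpred0 ?subrr. Qed.

Lemma gr_clsD i x y : x \in F i -> y \in F i ->
  gr_cls i (x + y) = gr_cls i x + gr_cls i y.
Proof.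
move=> Fx Fy; rewrite -[y in LHS]opprK gr_clsB ?rpredN //.
by rewrite -[- y]sub0r gr_clsB ?rpred0 // gr_cls0 sub0r opprK.
Qed.

Lemma gr_cls_sum i (I : Type) (r : seq I) (E : I -> B) :
  (forall k, E k \in F i) ->
  gr_cls i (\sum_(k <- r) E k) = \sum_(k <- r) gr_cls i (E k).
Proof.
move=> FE; elim: r => [|k r IHr]; first by rewrite !big_nil gr_cls0.
by rewrite !big_cons gr_clsD ?IHr // rpred_sum.
Qed.

Lemma gr_cls_eq0 i x : x \in F i -> (gr_cls i x == 0) = (x \in filt_prev i).
Proof.
move=> Fx; have -> : 0 = \pi_(gr_comp i) 0 by rewrite raddf0.
by rewrite /gr_cls -Quotient.idealrBE subr0 inE insubdK.
Qed.

(* The product gr_i x gr_j -> gr_k, used only for k = i + j. *)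
Definition gr_comp_mul i j k (u : gr_comp i) (v : gr_comp j) : gr_comp k :=
  gr_cls k (gr_rep u * gr_rep v).

Lemma gr_comp_mulE i j k x y : (i + j)%N = k -> x \in F i -> y \in F j ->
  gr_comp_mul k (gr_cls i x) (gr_cls j y) = gr_cls k (x * y).
Proof.
move=> <- Fx Fy; apply/eqP; rewrite -subr_eq0 /gr_comp_mul.
set x' := gr_rep _; set y' := gr_rep _.
have [Fx' Fy'] : x' \in F i /\ y' \in F j by split; apply: gr_rep_in.
have xx' : x' - x \in filt_prev i.
  by rewrite -gr_cls_eq0 ?rpredB // gr_clsB // gr_repK subrr.
have yy' : y' - y \in filt_prev j.
  by rewrite -gr_cls_eq0 ?rpredB // gr_clsB // gr_repK subrr.
rewrite -gr_clsB ?filtM // gr_cls_eq0; last by apply: rpredB; apply: filtM.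
have -> : x' * y' - x * y = (x' - x) * y' + x * (y' - y).
  by rewrite mulrBl mulrBr addrA subrK.
by apply: rpredD; [apply: filt_prevMl | apply: filt_prevMr].
Qed.

(* gr B: finitely supported families, i.e. the direct sum of the components. *)
Record gr := Gr {
  gr_val :> forall i, gr_comp i;
  gr_fin : exists n, forall i, (n <= i)%N -> gr_val i = 0
}.

HB.instance Definition _ := gen_eqMixin gr.
HB.instance Definition _ := gen_choiceMixin gr.

Lemma grP (x y : gr) : (forall i, x i = y i) -> x = y.
Proof.
case: x y => [x fx] [y fy] /= exy.
have {}exy : x = y by apply: functional_extensionality_dep.
by case: _ / exy fy => fy; congr Gr; apply: Prop_irrelevance.
Qed.

Lemma gr_zero_fin : exists n, forall i, (n <= i)%N -> (0 : gr_comp i) = 0.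
Proof. by exists 0. Qed.
Definition gr_zero := Gr gr_zero_fin.

Lemma gr_one_fin : exists n, forall i, (n <= i)%N ->
  (if i is 0 then gr_cls i 1 else 0) = 0.
Proof. by exists 1%N => -[]. Qed.
Definition gr_one := @Gr (fun i => if i is 0 then gr_cls i 1 else 0) gr_one_fin.

Lemma gr_opp_fin (x : gr) : exists n, forall i, (n <= i)%N -> - x i = 0.
Proof. by case: (gr_fin x) => n xn; exists n => i /xn->; rewrite oppr0. Qed.
Definition gr_opp x := Gr (gr_opp_fin x).

Lemma gr_add_fin (x y : gr) :
  exists n, forall i, (n <= i)%N -> x i + y i = 0.
Proof.
case: (gr_fin x) (gr_fin y) => n xn [m ym]; exists (maxn n m) => i.
by rewrite geq_max => /andP[/xn-> /ym->]; rewrite addr0.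
Qed.
Definition gr_add x y := Gr (gr_add_fin x y).

Lemma gr_comp_mul0l i j k (v : gr_comp j) :
  (i + j)%N = k -> gr_comp_mul k (0 : gr_comp i) v = 0.
Proof.
move=> ijk; rewrite -(gr_cls0 i) -[v]gr_repK gr_comp_mulE ?gr_rep_in ?rpred0 //.
by rewrite mul0r gr_cls0.
Qed.

Lemma gr_comp_mul0r i j k (u : gr_comp i) :
  (i + j)%N = k -> gr_comp_mul k u (0 : gr_comp j) = 0.
Proof.
move=> ijk; rewrite -(gr_cls0 j) -[u]gr_repK gr_comp_mulE ?gr_rep_in ?rpred0 //.
by rewrite mulr0 gr_cls0.
Qed.

Lemma gr_mul_fin (x y : gr) : exists n, forall k, (n <= k)%N ->
  \sum_(i < k.+1) gr_comp_mul k (x i) (y (k - i)%N) = 0.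
Proof.
case: (gr_fin x) (gr_fin y) => n xn [m ym]; exists (n + m)%N => k lek.
apply: big1 => i _; have ik : (i + (k - i))%N = k by rewrite subnKC -1?ltnS.
have [ni|ltin] := leqP n i; first by rewrite xn // gr_comp_mul0l.
rewrite (ym (k - i)%N) ?gr_comp_mul0r // -(leq_add2l i) ik.
by rewrite (leq_trans _ lek) // leq_add2r ltnW.
Qed.
Definition gr_mul x y := Gr (gr_mul_fin x y).

Definition gr_conv (p q : nat -> B) k := \sum_(i < k.+1) p i * q (k - i)%N.

Definition gr_trunc n (p : nat -> B) := \poly_(i < n) p i.

Lemma gr_convE n p q k : (k < n)%N -> gr_conv p q k = (gr_trunc n p * gr_trunc n q)`_k.
Proof.
move=> ltkn; rewrite coefM; apply: eq_bigr => i _; rewrite !coef_poly.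
by rewrite (leq_ltn_trans (leq_subr i k) ltkn) (leq_trans (ltn_ord i) ltkn).
Qed.

Lemma gr_convA p q r k : gr_conv p (gr_conv q r) k = gr_conv (gr_conv p q) r k.
Proof.
have ord i : (k - i < k.+1)%N by rewrite ltnS leq_subr.
transitivity (gr_trunc k.+1 p * gr_trunc k.+1 q * gr_trunc k.+1 r)`_k.
  rewrite -mulrA coefM; apply: eq_bigr => i _.
  by rewrite coef_poly ltn_ord (@gr_convE k.+1) ?ord.
rewrite coefM; apply: eq_bigr => i _.
by rewrite coef_poly ord // -gr_convE.
Qed.

Lemma gr_conv_in p q : (forall i, p i \in F i) -> (forall i, q i \in F i) ->
  forall k, gr_conv p q k \in F k.
Proof.
move=> Fp Fq k; apply: rpred_sum => i _.
have ik : (i + (k - i))%N = k by rewrite subnKC -1?ltnS.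
by have := filtM (Fp i) (Fq (k - i)%N); rewrite ik.
Qed.

Lemma gr_mul_conv (x y : gr) p q :
  (forall i, p i \in F i) -> (forall i, q i \in F i) ->
  (forall i, x i = gr_cls i (p i)) -> (forall i, y i = gr_cls i (q i)) ->
  forall k, gr_mul x y k = gr_cls k (gr_conv p q k).
Proof.
move=> Fp Fq xp yq k.
have ik (i : 'I_k.+1) : (i + (k - i))%N = k by rewrite subnKC -1?ltnS.
rewrite gr_cls_sum => [|i]; last first.
  by have := filtM (Fp i) (Fq (k - i)%N); rewrite ik.
by apply: eq_bigr => i _; rewrite xp yq gr_comp_mulE.
Qed.

Definition gr_reps (x : gr) i := gr_rep (x i).
Lemma gr_repsF (x : gr) i : gr_reps x i \in F i.
Proof. exact: gr_rep_in. Qed.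
Lemma gr_repsE (x : gr) i : x i = gr_cls i (gr_reps x i).
Proof. by rewrite gr_repK. Qed.

Definition gr_one_rep i : B := (i == 0%N)%:R.
Lemma gr_one_repF i : gr_one_rep i \in F i.
Proof. by case: i => [|i]; [apply: filt1 | apply: rpred0]. Qed.
Lemma gr_one_repE i : gr_one i = gr_cls i (gr_one_rep i).
Proof. by case: i => [|i] //=; rewrite gr_cls0. Qed.

Lemma gr_addA : associative gr_add.
Proof. by move=> x y z; apply: grP => i; apply: addrA. Qed.
Lemma gr_addC : commutative gr_add.
Proof. by move=> x y; apply: grP => i; apply: addrC. Qed.
Lemma gr_add0 : left_id gr_zero gr_add.
Proof. by move=> x; apply: grP => i; apply: add0r. Qed.
Lemma gr_addN : left_inverse gr_zero gr_opp gr_add.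
Proof. by move=> x; apply: grP => i; apply: addNr. Qed.

HB.instance Definition _ :=
  GRing.isZmodule.Build gr gr_addA gr_addC gr_add0 gr_addN.

Lemma gr_mulA : associative gr_mul.
Proof.
move=> x y z; apply: grP => k.
have xyE := gr_mul_conv (gr_repsF x) (gr_repsF y) (gr_repsE x) (gr_repsE y).
have yzE := gr_mul_conv (gr_repsF y) (gr_repsF z) (gr_repsE y) (gr_repsE z).
have xyF := gr_conv_in (gr_repsF x) (gr_repsF y).
have yzF := gr_conv_in (gr_repsF y) (gr_repsF z).
rewrite (gr_mul_conv (gr_repsF x) yzF (gr_repsE x) yzE) gr_convA.
by rewrite (gr_mul_conv xyF (gr_repsF z) xyE (gr_repsE z)).
Qed.

Lemma gr_mul1l : left_id gr_one gr_mul.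
Proof.
move=> x; apply: grP => k.
rewrite (gr_mul_conv gr_one_repF (gr_repsF x) gr_one_repE (gr_repsE x)).
rewrite /gr_conv big_ord_recl big1 => [|i _]; last by rewrite mul0r.
by rewrite mul1r addr0 subn0 -gr_repsE.
Qed.

Lemma gr_mul1r : right_id gr_one gr_mul.
Proof.
move=> x; apply: grP => k.
rewrite (gr_mul_conv (gr_repsF x) gr_one_repF (gr_repsE x) gr_one_repE).
rewrite /gr_conv big_ord_recr big1 /= => [|i _].
  by rewrite add0r subnn mulr1 -gr_repsE.
by rewrite /gr_one_rep subn_eq0 leqNgt ltn_ord mulr0.
Qed.

Lemma gr_mulDl : left_distributive gr_mul gr_add.
Proof.
move=> x y z; apply: grP => k.
pose p i := gr_reps x i + gr_reps y i.
have pF i : p i \in F i by apply: rpredD; apply: gr_rep_in.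
have pE i : gr_add x y i = gr_cls i (p i).
  by rewrite gr_clsD ?gr_rep_in // !gr_repK.
rewrite (gr_mul_conv pF (gr_repsF z) pE (gr_repsE z)).
change (gr_cls k (gr_conv p (gr_reps z) k) = gr_mul x z k + gr_mul y z k).
rewrite (gr_mul_conv (gr_repsF x) (gr_repsF z) (gr_repsE x) (gr_repsE z)).
rewrite (gr_mul_conv (gr_repsF y) (gr_repsF z) (gr_repsE y) (gr_repsE z)).
rewrite -gr_clsD; try by apply: gr_conv_in => i; apply: gr_rep_in.
congr (gr_cls k _).
by rewrite /gr_conv -big_split; apply: eq_bigr => i _; rewrite mulrDl.
Qed.

Lemma gr_mulDr : right_distributive gr_mul gr_add.
Proof.
move=> x y z; apply: grP => k.
pose p i := gr_reps y i + gr_reps z i.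
have pF i : p i \in F i by apply: rpredD; apply: gr_rep_in.
have pE i : gr_add y z i = gr_cls i (p i).
  by rewrite gr_clsD ?gr_rep_in // !gr_repK.
rewrite (gr_mul_conv (gr_repsF x) pF (gr_repsE x) pE).
change (gr_cls k (gr_conv (gr_reps x) p k) = gr_mul x y k + gr_mul x z k).
rewrite (gr_mul_conv (gr_repsF x) (gr_repsF y) (gr_repsE x) (gr_repsE y)).
rewrite (gr_mul_conv (gr_repsF x) (gr_repsF z) (gr_repsE x) (gr_repsE z)).
rewrite -gr_clsD; try by apply: gr_conv_in => i; apply: gr_rep_in.
congr (gr_cls k _).
by rewrite /gr_conv -big_split; apply: eq_bigr => i _; rewrite mulrDr.
Qed.

Lemma gr_one_neq0 : gr_one != 0 :> gr.
Proof.
apply/eqP => /(congr1 (fun x : gr => x 0%N)) /= /eqP.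
by rewrite gr_cls_eq0 ?filt1 //= inE oner_eq0.
Qed.

HB.instance Definition _ := GRing.Zmodule_isNzRing.Build gr
  gr_mulA gr_mul1l gr_mul1r gr_mulDl gr_mulDr gr_one_neq0.

End AssociatedGraded.

Section InnerDerivation.
Variables (K : fieldType) (B : algType K).

Definition ad (u b : B) : B := u * b - b * u.

Definition is_eigenvalue (delta : B -> B) (lambda : K) : Prop :=
  exists2 b : B, b != 0 & delta b = lambda *: b.

End InnerDerivation.

(* Main.v *)
Require Import Defs.
From mathcomp Require Import all_boot all_order all_algebra.

Set Implicit Arguments.
Unset Strict Implicit.
Unset Printing Implicit Defensive.

Import GRing.Theory.
Local Open Scope ring_scope.

(** Write [d] for the degree of [a] and [n > 1] for that of [f].  Left and right
    multiplication by [a] commute, so [ad f(a)] factors as [G \o ad a], where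
    [G] is the divided difference of [f] evaluated at these two operators.
    Modulo lower degree [G] is multiplication by [n f_n a^(n-1)], because gr B
    is commutative; since gr B is a domain of characteristic zero, [G] raises
    degrees by exactly [(n-1) d] when [d > 0] ([divdiff_alg_notin]).

    If [ad f(a) b = lambda b] with [lambda != 0], then [c = ad a b] satisfies
    [G c = lambda b], so for [d > 0] it is zero or has degree
    [deg b - (n-1) d < deg b].  When [d = 0], [ad a] lowers degrees because gr B is commutative.  Either
    way [ad a] strictly lowers the degree of eigenvectors ([ad_eigen_prev]).  As
    [ad a] commutes with [ad f(a)], [c] satisfies the same eigenvalue equation;
    descending on the degree gives [c = 0], hence [lambda b = G c = 0]. *)

(** * Reading gr B inside B *)

Section Graded.
Variables (K : fieldType) (B : algType K) (F : filtration B).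

Lemma filtZ i (k : K) x : x \in F i -> k *: x \in F i.
Proof.
have [F0 FP] := filt_submod F i => Fx.
by rewrite -[k *: x]addr0; apply: FP.
Qed.

Lemma filt_prevZ i (k : K) x : x \in filt_prev F i -> k *: x \in filt_prev F i.
Proof.
by case: i => [|i] /=; [rewrite !inE => /eqP->; rewrite scaler0 | apply: filtZ].
Qed.

Lemma filt_prev_lt i j : (i < j)%N -> {subset F i <= filt_prev F j}.
Proof. by case: j => // j lij x; apply: filt_le. Qed.

Lemma filtX i x n : x \in F i -> x ^+ n \in F (n * i)%N.
Proof.
move=> Fx; elim: n => [|n IHn]; first exact: filt1.
by rewrite exprS mulSn; apply: filtM.
Qed.

Lemma filt_degree x : x != 0 ->
  exists i, x \in F i /\ x \notin filt_prev F i.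
Proof.
move=> x0; case: (ex_minnP (filt_exhaustive F x)) => i Fx min_i.
exists i; split=> //; case: i Fx min_i => [|i] _ min_i; first by rewrite inE.
by apply/negP => /min_i; rewrite ltnn.
Qed.

Lemma gr_hom_fin i x : exists n, forall j, (n <= j)%N ->
  gr_cls F j (if j == i then x else 0) = 0.
Proof. by exists i.+1 => j ltij; rewrite gtn_eqF // gr_cls0. Qed.

(** The homogeneous element of degree [i] given by [x].  Testing the degree on
    the representative rather than on the class avoids transporting
    [gr_cls F i x] along [j = i]. *)
Definition gr_hom i x : gr F := Gr (gr_hom_fin i x).

Lemma gr_hom_eq0 i x : x \in F i -> gr_hom i x = 0 -> x \in filt_prev F i.
Proof.
move=> Fx /(congr1 (fun u : gr F => u i)) /= /eqP.
by rewrite eqxx gr_cls_eq0.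
Qed.

Lemma gr_homM i j x y : x \in F i -> y \in F j ->
  gr_hom i x * gr_hom j y = gr_hom (i + j)%N (x * y).
Proof.
have Fif k z : z \in F k -> forall l, (if l == k then z else 0) \in F l.
  by move=> Fz l; case: eqP => [->|_] //; apply: rpred0.
move=> Fx Fy; apply: grP => k.
rewrite [LHS](@gr_mul_conv _ _ _ _ _ _ _ (Fif _ _ Fx) (Fif _ _ Fy)) //=.
congr (gr_cls F k _); rewrite /gr_conv.
have [ltki|leik] := ltnP k i.
  (* Below degree i every term of the convolution has a zero left factor. *)
  rewrite ltn_eqF ?(leq_trans ltki) ?leq_addr // big1 // => l _.
  by rewrite ltn_eqF ?mul0r // (leq_trans (ltn_ord l)).
rewrite (bigD1 (Ordinal (leik : i < k.+1)%N)) //= eqxx big1 => [|l /negPf li].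
  rewrite addr0 -(eqn_add2l i (k - i)%N) subnKC //.
  by case: (k == _); rewrite ?mulr0.
by rewrite -val_eqE /= in li; rewrite li mul0r.
Qed.

Lemma filt_commutator (grC : commutative (@GRing.mul (gr F))) i j x y :
  x \in F i -> y \in F j -> x * y - y * x \in filt_prev F (i + j)%N.
Proof.
move=> Fx Fy; have Fxy := filtM Fx Fy.
have Fyx : y * x \in F (i + j)%N by rewrite addnC filtM.
rewrite -gr_cls_eq0 ?rpredB // gr_clsB // subr_eq0.
have := grC (gr_hom i x) (gr_hom j y); rewrite !gr_homM //.
move=> /(congr1 (fun u : gr F => u (i + j)%N)) /=.
by rewrite [(j + i)%N]addnC eqxx => ->.
Qed.

Lemma filt_mul_notin (grD : GRing.integral_domain_axiom (gr F)) i j x y :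
  x \in F i -> y \in F j -> x \notin filt_prev F i -> y \notin filt_prev F j ->
  x * y \notin filt_prev F (i + j)%N.
Proof.
move=> Fx Fy nFx nFy; apply: contra nFx => Fxy.
have : gr_hom i x * gr_hom j y = 0.
  rewrite gr_homM //; apply: grP => k /=.
  have [->|_] := k =P (i + j)%N; last by rewrite gr_cls0.
  by apply/eqP; rewrite gr_cls_eq0 // filtM.
move=> /grD /orP[] /eqP /gr_hom_eq0; first exact.
by move=> /(_ Fy) Fy'; rewrite Fy' in nFy.
Qed.

Lemma filt_exp_notin (grD : GRing.integral_domain_axiom (gr F)) i x n :
  x \in F i -> x \notin filt_prev F i -> x ^+ n \notin filt_prev F (n * i)%N.
Proof.
move=> Fx nFx; elim: n => [|n IHn]; first by rewrite expr0 inE oner_eq0.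
by rewrite exprS mulSn; apply: filt_mul_notin => //; apply: filtX.
Qed.

End Graded.

(** * Divided differences of polynomials in a *)

Section DividedDifference.
Variables (K : fieldType) (B : algType K) (a : B).

(** The divided difference [(X^m - Y^m) / (X - Y)] at the left and right
    multiplications by [a]. *)
Definition divdiffX m (c : B) := \sum_(i < m) a ^+ i * c * a ^+ (m - i.+1).

Definition divdiff_alg (f : {poly K}) (c : B) :=
  \sum_(m < size f) f`_m *: divdiffX m c.

Lemma ad_exp m b : ad (a ^+ m) b = divdiffX m (ad a b).
Proof.
elim: m => [|m IHm]; first by rewrite /divdiffX big_ord0 /ad mul1r mulr1 subrr.
rewrite /divdiffX big_ord_recl mul1r subn1 /=.
under eq_bigr => i _ do rewrite /bump add1n subSS exprS -!mulrA.
rewrite -mulr_sumr; under eq_bigr => i _ do rewrite mulrA.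
rewrite -[\sum_(i < m) _]/(divdiffX m (ad a b)) -IHm /ad exprS.
by rewrite mulrBr mulrBl !mulrA [RHS]addrC addrA subrK.
Qed.

Lemma horner_alg_sum (f : {poly K}) :
  horner_alg a f = \sum_(m < size f) f`_m *: a ^+ m.
Proof.
rewrite -[in LHS](coefK f) poly_def linear_sum.
by apply: eq_bigr => m _; rewrite linearZ rmorphXn /= horner_algX mulr_algl.
Qed.

Lemma ad_horner_alg (f : {poly K}) b :
  ad (horner_alg a f) b = divdiff_alg f (ad a b).
Proof.
rewrite horner_alg_sum /ad mulr_suml mulr_sumr -sumrB.
by apply: eq_bigr => m _; rewrite -scalerAl -scalerAr -scalerBr -ad_exp.
Qed.

Lemma divdiff_alg0 (f : {poly K}) : divdiff_alg f 0 = 0.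
Proof.
apply: big1 => m _; rewrite /divdiffX big1 ?scaler0 // => i _.
by rewrite mulr0 mul0r.
Qed.

Lemma ad_horner_alg_comm (f : {poly K}) b :
  ad (horner_alg a f) (ad a b) = ad a (ad (horner_alg a f) b).
Proof.
set u := horner_alg a f.
have ua : u * a = a * u.
  by rewrite /u -{2 3}(horner_algX a) -!rmorphM mulrC.
rewrite /ad !mulrBr !mulrBl !mulrA ua -!mulrA ua !opprB.
by rewrite addrACA [RHS]addrACA; congr (_ + _); rewrite addrC.
Qed.

End DividedDifference.

Section Degrees.
Variables (K : fieldType) (B : algType K) (F : filtration B).
Hypothesis grC : commutative (@GRing.mul (gr F)).

(** Each of the [m.+1] summands [a^i c a^(m-i)] is [a^m c] modulo lower degree,
    because moving [a^(m-i)] across [c] costs a commutator. *)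
Lemma divdiffX_lead a c d k m : a \in F d -> c \in F k ->
  divdiffX a m.+1 c - m.+1%:R *: (a ^+ m * c) \in filt_prev F (m * d + k)%N.
Proof.
move=> Fa Fc; rewrite scaler_nat -[X in _ *+ X]card_ord -sumr_const -sumrB.
apply: rpred_sum => i _; rewrite subSS.
have im : (i + (m - i))%N = m by rewrite subnKC -1?ltnS.
rewrite -[X in (X * d)%N]im mulnDl -addnA.
have -> : a ^+ m = a ^+ i * a ^+ (m - i) by rewrite -exprD im.
rewrite -!mulrA -mulrBr.
apply: filt_prevMr; first exact: filtX.
by rewrite addnC; apply: filt_commutator => //; apply: filtX.
Qed.

Lemma divdiffX_in a c d k m : a \in F d -> c \in F k ->
  divdiffX a m.+1 c \in F (m * d + k)%N.
Proof.
move=> Fa Fc; rewrite -[divdiffX _ _ _](subrK (m.+1%:R *: (a ^+ m * c))).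
apply: rpredD; first exact/filt_prev_sub/divdiffX_lead.
by apply/filtZ/filtM => //; apply: filtX.
Qed.

(** Positivity of the degree of [a] makes the terms of [f] below the top one
    contribute in strictly lower degree, and characteristic zero keeps the
    factor [n.+1] of the top one invertible. *)
Lemma divdiff_alg_notin (charK0 : [pchar K] =i pred0)
    (grD : GRing.integral_domain_axiom (gr F)) (f : {poly K}) a c d k n :
  size f = n.+2 -> (0 < d)%N ->
  a \in F d -> a \notin filt_prev F d -> c \in F k -> c \notin filt_prev F k ->
  divdiff_alg a f c \notin filt_prev F (n * d + k)%N.
Proof.
move=> szf d0 Fa nFa Fc nFc; rewrite /divdiff_alg szf big_ord_recr /=.
set low := \sum_(_ < _) _; set r := filt_prev F _.
have lowF : low \in r.
  apply: rpred_sum => -[[|i] /= lti] _; apply: filt_prevZ.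
    by rewrite /divdiffX big_ord0 rpred0.
  apply: (@filt_prev_lt _ _ _ (i * d + k)%N); last exact: divdiffX_in.
  by rewrite ltn_add2r ltn_mul2r d0.
have fn0 : f`_n.+1 != 0.
  by have := lead_coef_eq0 f; rewrite lead_coefE szf -size_poly_eq0 szf => ->.
have nK0 : n.+1%:R != 0 :> K by rewrite ((pcharf0P K).1 charK0).
have : a ^+ n * c \notin r.
  by apply: filt_mul_notin => //; [apply: filtX | apply: filt_exp_notin].
apply: contra; rewrite (rpredDl _ lowF).
move=> /(filt_prevZ (f`_n.+1)^-1); rewrite scalerA mulVf // scale1r => DF.
have := rpredB DF (divdiffX_lead n Fa Fc); rewrite subKr.
by move=> /(filt_prevZ n.+1%:R^-1); rewrite scalerA mulVf // scale1r.
Qed.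

(** If [a] has positive degree and [c = ad a b] had degree [k >= j], then
    [lambda b = divdiff_alg a f c] would have degree [(n-1) d + k > j], with [d]
    the degree of [a] and [n] that of [f]; this is where [n > 1] matters. *)
Lemma ad_eigen_prev (charK0 : [pchar K] =i pred0)
    (grD : GRing.integral_domain_axiom (gr F)) (f : {poly K}) a b lambda j :
  (2 < size f)%N -> b \in F j -> ad (horner_alg a f) b = lambda *: b ->
  ad a b \in filt_prev F j.
Proof.
move=> deg_f Fb fab; have [Fa|nFa] := boolP (a \in F 0).
  exact: (filt_commutator grC Fa Fb).
have a0 : a != 0 by apply: contraNneq nFa => ->; rewrite rpred0.
have [d [Fd nFd]] := filt_degree F a0.
have d0 : (0 < d)%N by case: d Fd {nFd} => // Fd; rewrite Fd in nFa.
have [->|c0] := eqVneq (ad a b) 0; first exact: rpred0.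
have [k [Fk nFk]] := filt_degree F c0.
have [/filt_prev_lt|lejk] := ltnP k j; first exact.
case szf: (size f) deg_f => [|[|n]] //; rewrite !ltnS => n0.
have /negP[] := divdiff_alg_notin charK0 grD szf d0 Fd nFd Fk nFk.
rewrite -ad_horner_alg fab; apply/filt_prevZ/(filt_prev_lt _ Fb).
by rewrite (leq_ltn_trans lejk) // -[ltnLHS]add0n ltn_add2r muln_gt0 n0.
Qed.

End Degrees.

Theorem theorem1p1 (K : fieldType) (charK0 : [pchar K] =i pred0)
    (B : algType K) (F : filtration B)
    (grC : commutative (@GRing.mul (gr F)))
    (grD : GRing.integral_domain_axiom (gr F))
    (a : B) (f : {poly K}) (deg_f : (2 < size f)%N)
    (ad_neq0 : ~ ad (horner_alg a f) =1 \0) :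
  forall lambda : K, is_eigenvalue (ad (horner_alg a f)) lambda <-> lambda = 0.
Proof.
move=> lambda; split=> [[b b0 fab]|->]; last first.
  by exists 1; rewrite ?oner_eq0 // /ad mulr1 mul1r subrr scale0r.
apply/eqP; apply: contraNT b0 => l0; apply/eqP.
have [j Fb] := filt_exhaustive F b.
have ad_inj x : ad (horner_alg a f) x = lambda *: x -> ad a x = 0 -> x = 0.
  rewrite ad_horner_alg => + ax0; rewrite ax0 divdiff_alg0 => /esym/eqP.
  by rewrite scaler_eq0 (negPf l0) => /eqP.
elim: j b Fb fab => [|j IHj] b Fb fab; apply: ad_inj => //;
  have Fc := ad_eigen_prev grC charK0 grD deg_f Fb fab; first exact/eqP.
apply: IHj => //; rewrite ad_horner_alg_comm fab.
by rewrite /ad -scalerAr -scalerAl -scalerBr.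
Qed.
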